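(* Let $X$ be a compact metric space, $\mathcal{H}$ a real separable Hilbert space, and $C(X,\mathcal{H})$ the space of continuous functions from $X$ to $\mathcal{H}$ with the supremum norm. Let $\Gamma$ be a group acting on $X$ by homeomorphisms, and let $I=\pi+\rho$ be an affine isometric action of $\Gamma$ on $C(X,\mathcal{H})$, that is, $I(f)\varphi=\pi(f)\varphi+\rho(f)$, where $\rho:\Gamma\to C(X,\mathcal{H})$ satisfies $\rho(fg)=\rho(f)+\pi(f)\rho(g)$ and where $\pi$ is the action by linear isometries given by $$\pi(f)\varphi(x)=\Psi(f,f^{-1}(x))\,\varphi(f^{-1}(x)),$$ with $\Psi:\Gamma\times X\to O(\mathcal{H})$ satisfying $\Psi(fg,x)=\Psi(f,g(x))\Psi(g,x)$ for all $f,g\in\Gamma$ and $x\in X$. Assume that the action of $\Gamma$ on $X$ is minimal. If the action $I$ on $C(X,\mathcal{H})$ has a bounded orbit, then it has a fixed point, i.e. there is $\varphi_0\in C(X,\mathcal{H})$ with $I(f)\varphi_0=\varphi_0$ for all $f\in\Gamma$.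
   Context: $O(\mathcal{H})$ is the group of surjective linear isometries of $\mathcal{H}$. It is part of the setting that each $\pi(f)$ maps $C(X,\mathcal{H})$ to itself. (By the Mazur–Ulam theorem and the vector-valued Banach–Stone theorem, actions by isometries of $C(X,\mathcal{H})$ have the form described.) The action on $X$ is minimal if every orbit is dense in $X$. *)

(* Defs.v *)
From HB Require Import structures.
From mathcomp Require Import all_boot all_order all_algebra.
From mathcomp Require Import all_classical all_reals all_analysis.

Set Implicit Arguments.
Unset Strict Implicit.
Unset Printing Implicit Defensive.

Import Order.TTheory GRing.Theory Num.Theory.
Import numFieldNormedType.Exports.

Local Open Scope classical_set_scope.
Local Open Scope ring_scope.

HB.mixin Record isCompactSpace (T : Type) & Topological T := {
  compact_setT : compact [set: T]
}.

(* Not assumed to be nonempty. *)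
#[short(type="compactMetricType")]
HB.structure Definition CompactMetric (R : realType) :=
  {T of Metric R T & isCompactSpace T}.

(* [{dot H for idfun}] is the type of symmetric positive definite bilinear
   forms on [H]. *)
HB.mixin Record isHilbert (R : realType) (H : Type)
    & CompleteNormedModule R H := {
  inner : {dot H for (@idfun R)} ;
  sqr_norm_inner : forall u : H, `|u| ^+ 2 = inner u u
}.

#[short(type="hilbertType")]
HB.structure Definition Hilbert (R : realType) :=
  {H of CompleteNormedModule R H & isHilbert R H}.

Definition separable (T : topologicalType) :=
  exists2 D : set T, countable D & dense D.

Record orthogonal_operator (R : realType) (H : hilbertType R) := OrthogonalOperator {
  orth_linear :> {linear H -> H} ;
  orth_norm : forall u : H, `|orth_linear u| = `|u| ;
  orth_surj : forall v : H, exists u : H, orth_linear u = v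
}.

(* Each [act g] is a homeomorphism: its inverse [act g^-1] is continuous too. *)
Record homeo_action (G : groupType) (X : topologicalType) := HomeoAction {
  act :> G -> X -> X ;
  act1 : forall x, act 1%g x = x ;
  actM : forall f g x, act (f * g)%g x = act f (act g x) ;
  act_continuous : forall g, continuous (act g)
}.

Definition minimal_action (G : groupType) (X : topologicalType)
    (a : homeo_action G X) :=
  forall x : X, dense (range (a^~ x)).

Definition cspace (R : realType) (X : compactMetricType R)
  (V : normedModType R) : Type := continuousType X V.

Section cspace_lmodule.
Context (R : realType) (X : compactMetricType R) (V : normedModType R).

HB.instance Definition _ := Choice.copy (cspace X V) (continuousType X V).

Implicit Types (phi psi : cspace X V) (c : R).

Lemma cspace_continuous phi : continuous phi.
Proof. exact: (@cts_fun _ _ (phi : continuousType X V)). Qed.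

Lemma cspaceP phi psi : (forall x, phi x = psi x) -> phi = psi.
Proof. by move=> h; apply/continuousEP. Qed.

Definition Cspace (f : X -> V) (cf : continuous f) : cspace X V :=
  (mkcts cf : continuousType X V).

Let zero_cts : continuous (fun _ : X => 0 : V).
Proof. by move=> x; exact: cvg_cst. Qed.

Let opp_cts phi : continuous (fun x => - phi x).
Proof. by move=> x; apply: cvgN; exact: cspace_continuous. Qed.

Let add_cts phi psi : continuous (fun x => phi x + psi x).
Proof. by move=> x; apply: cvgD; exact: cspace_continuous. Qed.

Let scale_cts c phi : continuous (fun x => c *: phi x).
Proof. by move=> x; apply: cvgZl_tmp; exact: cspace_continuous. Qed.

Let zero := Cspace zero_cts.
Let opp phi := Cspace (@opp_cts phi).
Let add phi psi := Cspace (@add_cts phi psi).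
Let scale c phi := Cspace (@scale_cts c phi).

Let addA : associative add.
Proof. by move=> f g h; apply: cspaceP => x; exact: addrA. Qed.
Let addC : commutative add.
Proof. by move=> f g; apply: cspaceP => x; exact: addrC. Qed.
Let add0 : left_id zero add.
Proof. by move=> f; apply: cspaceP => x; exact: add0r. Qed.
Let addN : left_inverse zero opp add.
Proof. by move=> f; apply: cspaceP => x; exact: addNr. Qed.

HB.instance Definition _ :=
  GRing.isZmodule.Build (cspace X V) addA addC add0 addN.

Let scaleA a b phi : scale a (scale b phi) = scale (a * b) phi.
Proof. by apply: cspaceP => x; exact: scalerA. Qed.
Let scale1 : left_id 1 scale.
Proof. by move=> f; apply: cspaceP => x; exact: scale1r. Qed.
Let scaleDr : right_distributive scale +%R.
Proof. by move=> c f g; apply: cspaceP => x; exact: scalerDr. Qed.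
Let scaleDl phi : {morph scale^~ phi : a b / a + b}.
Proof. by move=> a b; apply: cspaceP => x; exact: scalerDl. Qed.

HB.instance Definition _ :=
  GRing.Zmodule_isLmodule.Build R (cspace X V) scaleA scale1 scaleDr scaleDl.

Lemma cspace0E (x : X) : (0 : cspace X V) x = 0. Proof. by []. Qed.
Lemma cspaceNE phi x : (- phi) x = - phi x. Proof. by []. Qed.
Lemma cspaceDE phi psi x : (phi + psi) x = phi x + psi x. Proof. by []. Qed.
Lemma cspaceZE c phi x : (c *: phi) x = c *: phi x. Proof. by []. Qed.

(* For empty [X] this is [sup set0 = 0]. *)
Definition sup_norm phi : R := sup (range (fun x : X => `|phi x|)).

Let sup_norm_ubound phi : has_ubound (range (fun x : X => `|phi x|)).
Proof.
have cK : compact (range phi).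
  apply: continuous_compact; last exact: compact_setT.
  by apply: continuous_subspaceT; exact: cspace_continuous.
have [M [_ hM]] := compact_bounded cK.
exists (M + 1) => _ [x _ <-]; apply: (hM (M + 1)); first by rewrite ltrDl.
by exists x.
Qed.

Let sup_norm_ge phi x : `|phi x| <= sup_norm phi.
Proof. by apply: ub_le_sup; [exact: sup_norm_ubound | exists x]. Qed.

Let sup_norm_le phi (M : R) :
  0 <= M -> (forall x, `|phi x| <= M) -> sup_norm phi <= M.
Proof.
move=> M0 hM; rewrite /sup_norm; have [-> | /set0P ne] :=
  eqVneq (range (fun x : X => `|phi x|)) set0.
  by rewrite sup0.
by apply: ge_sup => // _ [x _ <-].
Qed.

Let sup_norm_ge0 phi : 0 <= sup_norm phi.
Proof.
have [e | /set0P [_ [x _ _]]] :=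
  eqVneq (range (fun x : X => `|phi x|)) set0.
  by rewrite /sup_norm e sup0.
exact: le_trans (sup_norm_ge phi x).
Qed.

Let sup_normD phi psi : sup_norm (phi + psi) <= sup_norm phi + sup_norm psi.
Proof.
apply: sup_norm_le => [|x]; first by rewrite addr_ge0.
by rewrite cspaceDE (le_trans (ler_normD _ _))// lerD.
Qed.

Let sup_normZ_le c phi : sup_norm (c *: phi) <= `|c| * sup_norm phi.
Proof.
apply: sup_norm_le => [|x]; first by rewrite mulr_ge0.
by rewrite cspaceZE normrZ ler_wpM2l.
Qed.

Let sup_normZ c phi : sup_norm (c *: phi) = `|c| * sup_norm phi.
Proof.
apply/eqP; rewrite eq_le sup_normZ_le /=.
have [-> | c0] := eqVneq c 0; first by rewrite normr0 mul0r.
rewrite -[phi in leLHS]scale1r -(mulVf c0) -scalerA.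
by rewrite -ler_pdivlMl ?normr_gt0// -normfV.
Qed.

Let sup_norm0_eq0 phi : sup_norm phi = 0 -> phi = 0.
Proof.
move=> e; apply: cspaceP => x; apply/eqP.
by rewrite -normr_le0 -e.
Qed.

HB.instance Definition _ :=
  Lmodule_isNormed.Build R (cspace X V) sup_normD sup_normZ sup_norm0_eq0.

Lemma cspace_normE phi : `|phi| = sup (range (fun x : X => `|phi x|)).
Proof. by []. Qed.

End cspace_lmodule.

Arguments cspace {R} X V.

Section affine_action.
Context (R : realType) (X : compactMetricType R) (H : hilbertType R).
Context (G : groupType) (a : homeo_action G X).

Definition orthogonal_cocycle (Psi : G -> X -> orthogonal_operator H) :=
  forall f g x u, Psi (f * g)%g x u = Psi f (a g x) (Psi g x u).

(* As [pi f] is typed as a self-map of the space of continuous functions, this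
   includes the requirement that the weighted composition operators preserve
   continuity. *)
Definition weighted_rep (Psi : G -> X -> orthogonal_operator H)
    (pi : G -> cspace X H -> cspace X H) :=
  forall f phi x, pi f phi x = Psi f (a f^-1%g x) (phi (a f^-1%g x)).

Definition translation_cocycle (pi : G -> cspace X H -> cspace X H)
    (rho : G -> cspace X H) :=
  forall f g, rho (f * g)%g = rho f + pi f (rho g).

Definition affine_action (pi : G -> cspace X H -> cspace X H)
    (rho : G -> cspace X H) (f : G) (phi : cspace X H) : cspace X H :=
  pi f phi + rho f.

End affine_action.

(* Main.v *)
(** For [x] in [X] let [v f x] be the value at [x] of the bounded orbit.  The
    smallest radius [s] of a ball containing all the [v f x], [f] in [G], does
    not depend on [x], by minimality.  By the parallelogram law, two near-centers
    of a finite family whose radius is close to [s] are close to each other.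
    With completeness this gives each [v ^~ x] a unique Chebyshev center [c x];
    uniqueness makes [c] equivariant.  As finitely many of the continuous
    functions [v f] suffice to locate the center up to a given precision, [c] is
    continuous, and it is the fixed point. *)
Require Import Defs.
From HB Require Import structures.
From mathcomp Require Import all_boot all_order all_algebra.
From mathcomp Require Import ring lra.
From mathcomp Require Import all_classical all_reals all_analysis.

Import Order.TTheory GRing.Theory Num.Theory.
Import numFieldNormedType.Exports.

Local Open Scope classical_set_scope.
Local Open Scope ring_scope.

Lemma parallelogram {R : realType} {H : hilbertType R} (u w : H) :
  `|u + w| ^+ 2 + `|u - w| ^+ 2 = 2 * `|u| ^+ 2 + 2 * `|w| ^+ 2.
Proof.
rewrite !sqr_norm_inner linearDl linearBl !linearDr !linearNr /=; ring.
Qed.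

(** Apollonius' formula: the parallelogram law for [v - c] and [v - d]. The negative term is the
    gain in radius from moving to the midpoint. *)
Lemma sqr_dist_midpoint {R : realType} {H : hilbertType R} (v c d : H) :
  `|v - 2^-1 *: (c + d)| ^+ 2 =
  (`|v - c| ^+ 2 + `|v - d| ^+ 2) / 2 - `|c - d| ^+ 2 / 4.
Proof.
have := parallelogram (v - c) (v - d).
have -> : v - c + (v - d) = 2 *: (v - 2^-1 *: (c + d)).
  rewrite scalerBr scalerA divff ?pnatr_eq0// scale1r scaler_nat mulr2n.
  by rewrite opprD addrACA.
have -> : v - c - (v - d) = - (c - d).
  by rewrite opprB opprB addrC addrA subrK.
rewrite normrN normrZ gtr0_norm// exprMn; lra.
Qed.

Lemma near_forall_in {T : Type} {F : set_system T} {FF : Filter F}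
    {I : eqType} (s : seq I) (P : I -> T -> Prop) :
  (forall i, \forall x \near F, P i x) ->
  \forall x \near F, {in s, forall i, P i x}.
Proof.
move=> FP; elim: s => [|i s IH]; first exact: filterE.
apply: filterS2 (FP i) IH => x Pi Ps j.
by rewrite inE => /orP[/eqP->//|]; exact: Ps.
Qed.

Section chebyshev_center.
Context {R : realType} {H : hilbertType R} {I : eqType}.
Implicit Types (v w : I -> H) (F : seq I) (s t e d : R) (c : H).

Definition centers v F t : set H := [set c | {in F, forall i, `|v i - c| <= t}].

(* [s] is the supremum of the radii of the finite subfamilies of [v]. *)
Definition finite_radius v s :=
  (forall F d, 0 < d -> centers v F (s + d) !=set0) /\
  (forall d, 0 < d -> exists F, ~ (centers v F (s - d) !=set0)).

(** If [c1] and [c2] were [e] apart, their midpoint would be a center of radius [s - d]. The choice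
    of [d] precedes that of [F], so [finite_radius] can then supply an [F] for this [d]. *)
Lemma centers_close s e : 0 <= s -> 0 < e ->
  exists2 d, 0 < d & forall v F c1 c2, ~ (centers v F (s - d) !=set0) ->
    centers v F (s + d) c1 -> centers v F (s + d) c2 -> `|c1 - c2| < e.
Proof.
move=> s0 e0.
(* This gives [(s + d)^2 - e^2 / 4 < (s + d)(s - 3d) <= (s - d)^2]. *)
have [d d0 sde] : exists2 d, 0 < d & 16 * (s + d) * d < e ^+ 2.
  pose q := e ^+ 2 / (32 * (s + 1)).
  have q0 : 0 < q by rewrite divr_gt0 ?exprn_gt0// mulr_gt0// ltr_wpDl.
  have qE : q * (32 * (s + 1)) = e ^+ 2.
    by rewrite /q divfK// gt_eqF// mulr_gt0// ltr_wpDl.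
  have e20 : 0 < e ^+ 2 by rewrite exprn_gt0.
  exists (Num.min 1 q); first by rewrite lt_min ltr01.
  have m0 : 0 < Num.min 1 q by rewrite lt_min ltr01.
  have m1 : Num.min 1 q <= 1 by rewrite ge_min lexx.
  have mq : Num.min 1 q <= q by rewrite ge_min lexx orbT.
  move: (Num.min 1 q) m0 m1 mq => m m0 m1 mq; nra.
exists d => // v F c1 c2 nF c1F c2F; rewrite ltNge; apply/negP => ec.
apply: nF; exists (2^-1 *: (c1 + c2)) => i iF.
have h1 := c1F _ iF; have h2 := c2F _ iF.
have sd0 : 0 < s + d by rewrite ltr_wpDl.
have q1 : `|v i - c1| ^+ 2 <= (s + d) ^+ 2 by rewrite !expr2 ler_pM//.
have q2 : `|v i - c2| ^+ 2 <= (s + d) ^+ 2 by rewrite !expr2 ler_pM//.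
have q3 : e ^+ 2 <= `|c1 - c2| ^+ 2 by rewrite !expr2 ler_pM// ltW.
have mE := sqr_dist_midpoint (v i) c1 c2.
have m0 := sqr_ge0 `|v i - 2^-1 *: (c1 + c2)|.
have mlt : `|v i - 2^-1 *: (c1 + c2)| ^+ 2 < (s + d) * (s - 3 * d) by nra.
(* A square lies below the product, so [s - 3 * d] is positive; hence [s - d >= 0] and squares can
   be compared. *)
have s3d : 0 < s - 3 * d by rewrite -(pmulr_rgt0 _ sd0); exact: le_lt_trans mlt.
have sd : 0 <= s - d by lra.
rewrite -(ler_pXn2r (n := 2)) ?nnegrE//; apply: le_trans (ltW mlt) _; nra.
Qed.

Lemma chebyshev_center_unique v s c1 c2 : 0 <= s -> finite_radius v s ->
  (forall i, `|v i - c1| <= s) -> (forall i, `|v i - c2| <= s) -> c1 = c2.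
Proof.
move=> s0 [_ vs] h1 h2; apply/eqP; rewrite -subr_eq0 -normr_le0.
apply/ler_addgt0Pr => e e0; rewrite add0r.
have [d d0 hd] := centers_close s e s0 e0; have [F nF] := vs _ d0.
by apply/ltW/(hd v F) => // i _; rewrite ler_wpDr// ltW.
Qed.

(** The sets of near-centers form a filter base as [F] grows and [d] decreases. By [centers_close]
    the filter is Cauchy, and its limit is the center. *)
Lemma chebyshev_center_exists v s : 0 <= s -> finite_radius v s ->
  exists c, forall i, `|v i - c| <= s.
Proof.
move=> s0 [sv vs].
pose B (p : seq I * R) := centers v p.1 (s + p.2).
pose K := filter_from [set p : seq I * R | 0 < p.2] B.
have KF : Filter K.
  apply: filter_from_filter; first by exists ([::], 1) => /=.
  move=> [F d] [F' d'] /= d0 d0'; exists (F ++ F', Num.min d d').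
    by rewrite /= lt_min d0.
  move=> c /= hc; split => i /= iF; (apply: le_trans (hc i _) _;
    [by rewrite mem_cat iF ?orbT | by rewrite /= lerD2l ge_min lexx ?orbT]).
have KPF : ProperFilter K.
  by apply: filter_from_proper => -[F d] /= d0; exact: sv.
have /cauchy_cvg Kc : cauchy K.
  apply: cauchy_exP => e e0.
  have [d d0 hd] := centers_close s e s0 e0; have [F nF] := vs _ d0.
  have [c cF] := sv F d d0; exists c; exists (F, d) => //= z zF.
  by rewrite -ball_normE; exact: hd nF cF zF.
exists (lim K) => i; apply/ler_addgt0Pr => e e0.
have e20 : 0 < e / 2 by rewrite divr_gt0.
have KB : K (B ([:: i], e / 2)) by exists ([:: i], e / 2).
have Kb : K (ball (lim K) (e / 2)) by apply: Kc; exact: nbhsx_ballx.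
have [z [zB]] := filter_ex (filterI KB Kb).
rewrite -ball_normE /= => /ltW zb.
have zi : `|v i - z| <= s + e / 2 by apply: zB; rewrite inE.
have := ler_distD z (v i) (lim K); rewrite (distrC z); lra.
Qed.

End chebyshev_center.

Lemma norm_le_cspace {R : realType} {X : compactMetricType R}
    {V : normedModType R} (phi : cspace X V) x : `|phi x| <= `|phi|.
Proof.
rewrite cspace_normE; apply: ub_le_sup; last by exists x.
have : compact (range phi).
  apply: continuous_compact; last exact: compact_setT.
  by apply: continuous_subspaceT; exact: cspace_continuous.
move=> /compact_bounded[M [_ hM]].
exists (M + 1) => _ [y _ <-]; apply: (hM (M + 1)); first by rewrite ltrDl.
by exists y.
Qed.

Section equivariant_family.
Context {R : realType} {X : compactMetricType R} {H : hilbertType R}.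
Context {G : groupType} (a : homeo_action G X).
Context (A : G -> X -> H -> H) (v : G -> cspace X H).
Hypothesis A_dist : forall g x u w, `|A g x u - A g x w| = `|u - w|.
Hypothesis v_equiv : forall g f x, v (g * f)%g (a g x) = A g x (v f x).

Let vat x : G -> H := fun f => v f x.

(** [A g x] carries a center over [x] to one over [a g x]; the indices shift by [g^-1] to undo the
    translation in [v_equiv]. *)
Lemma centers_translate g x F t :
  centers (vat x) [seq (g^-1 * f)%g | f <- F] t !=set0 ->
  centers (vat (a g x)) F t !=set0.
Proof.
move=> [c hc]; exists (A g x c) => f fF.
rewrite /vat -[f](mulVKg g) v_equiv A_dist; apply: hc; exact: map_f.
Qed.

Lemma uniform_finite_radius (M : R) (x0 : X) : minimal_action a ->
  (forall f x, `|v f x| <= M) ->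
  exists2 s : R, 0 <= s & forall x, finite_radius (vat x) s.
Proof.
move=> amin vM.
pose S := [set t : R | forall F x, centers (vat x) F t !=set0].
have S_lb : lbound S 0.
  (* A nonempty family and a point of [X] force [t] to be nonnegative. *)
  move=> t /(_ [:: 1%g] x0)[c hc].
  exact: le_trans (normr_ge0 _) (hc _ (mem_head _ _)).
have S_inf : has_inf S.
  split; last by exists 0.
  by exists M => F x; exists 0 => f _; rewrite subr0; exact: vM.
exists (inf S); first exact: lb_le_inf S_inf.1 S_lb.
move=> x; split => [F d d0|d d0].
  have [t St tlt] := inf_adherent d0 S_inf.
  have [c hc] := St F x; exists c => f fF.
  exact: le_trans (hc f fF) (ltW tlt).
have d20 : 0 < d / 2 by rewrite divr_gt0.
have : ~ S (inf S - d / 2).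
  move=> /(ge_inf S_inf.2); lra.
move=> /existsNP[F /existsNP[y nF]].
(* Failure at [y] with radius [inf S - d / 2] persists near [y] with radius [inf S - d]. The orbit
   of [x] meets this neighborhood, and the failure is pulled back to [x]. *)
have U : \forall z \near y, {in F, forall f, `|v f y - v f z| <= d / 2}.
  apply: near_forall_in => f; apply: cvgr_dist_le => //.
  exact: cspace_continuous.
have [z [/interior_subset Uz [g _ gz]]] :=
  amin x _ (ex_intro _ y U : _^° !=set0) (open_interior _).
exists [seq (g^-1 * f)%g | f <- F] => /centers_translate[c hc].
apply: nF; exists c => f fF.
have := hc f fF; have := Uz f fF; rewrite -gz /vat.
have := ler_distD (v f (a g x)) (v f y) c; lra.
Qed.

Lemma equivariant_section (M : R) : minimal_action a ->
  (forall f x, `|v f x| <= M) ->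
  exists phi : cspace X H, forall g x, phi (a g x) = A g x (phi x).
Proof.
move=> amin vM.
have [[x0 _]|X0] := pselect ([set: X] !=set0); last first.
  by exists 0 => g x; case: X0; exists x.
have [s s0 hs] := uniform_finite_radius M x0 amin vM.
have /choice[c hc] : forall x, exists c, forall f, `|v f x - c| <= s.
  by move=> x; exact: chebyshev_center_exists s0 (hs x).
suff cc : continuous c.
  exists (Cspace cc) => g x /=.
  (* [A g x (c x)] is also a center of the family at [a g x]. *)
  apply: chebyshev_center_unique s0 (hs (a g x)) (hc _) _ => f.
  by rewrite /vat -[f](mulVKg g) v_equiv A_dist.
move=> x; apply/cvgrPdist_lt => e e0.
have [d d0 hd] := @centers_close _ H G s e s0 e0; have [F nF] := (hs x).2 _ d0.
have U : \forall z \near x, {in F, forall f, `|v f x - v f z| <= d}.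
  apply: near_forall_in => f; apply: cvgr_dist_le => //.
  exact: cspace_continuous.
(* For [z] near [x], both [c x] and [c z] are near-centers of the one family [vat x] on [F]. *)
apply: filterS U => z Fz; apply: (hd _ _ _ _ nF) => f fF; rewrite /vat.
  by rewrite ler_wpDr// ltW.
by rewrite (le_trans (ler_distD (v f z) _ _))// addrC lerD// Fz.
Qed.

End equivariant_family.

Theorem theoremC (R : realType) (X : compactMetricType R) (H : hilbertType R)
    (G : groupType) (a : homeo_action G X)
    (Psi : G -> X -> orthogonal_operator H)
    (pi : G -> cspace X H -> cspace X H) (rho : G -> cspace X H) :
  separable H ->
  orthogonal_cocycle a Psi ->
  weighted_rep a Psi pi ->
  translation_cocycle pi rho ->
  minimal_action a ->
  (exists phi : cspace X H,
     bounded_set (range (fun f : G => affine_action pi rho f phi))) ->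
  exists phi0 : cspace X H, forall f : G, affine_action pi rho f phi0 = phi0.
Proof.
move=> _ PsiM piE rhoM amin [phi [M [_ phiM]]].
have aK g x : a g^-1%g (a g x) = x by rewrite -actM mulVg act1.
have aVK g x : a g (a g^-1%g x) = x by rewrite -actM mulgV act1.
(* The affine action as a map from the fiber over [x] to the fiber over [a g x]; fixed points are
   then the equivariant sections. *)
pose A g x (u : H) := Psi g x u + rho g (a g x).
have actionE psi g x : affine_action pi rho g psi (a g x) = A g x (psi x).
  by rewrite /affine_action cspaceDE piE aK.
have A_dist g x u w : `|A g x u - A g x w| = `|u - w|.
  by rewrite /A opprD addrACA subrr addr0 -linearB orth_norm.
have AM g f x u : A (g * f)%g x u = A g (a f x) (A f x u).
  rewrite /A PsiM rhoM actM cspaceDE piE aK linearD /=.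
  by rewrite -addrA [X in _ + X]addrC.
have equiv g f x : affine_action pi rho (g * f)%g phi (a g x) =
    A g x (affine_action pi rho f phi x).
  rewrite -(aVK f x); move: (a _ x) => y.
  by rewrite -actM !actionE AM.
have [|phi0 hphi0] := equivariant_section a A _ A_dist equiv (M + 1) amin.
  move=> f x; apply: le_trans (norm_le_cspace _ x) _.
  (* [bounded_set] only provides the bounds strictly above [M], hence [M + 1]. *)
  by apply: (phiM (M + 1)); [rewrite ltrDl | exists f].
exists phi0 => f; apply: cspaceP => x.
rewrite -(aVK f x); move: (a _ x) => y.
by rewrite actionE hphi0.
Qed.
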